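(* For every real $\alpha$ with $-1<\alpha\le 1$, $$\int_0^1\frac{\log(1+\alpha x)}{x(1+x)}\,dx=\mathrm{Li}_2\left(\frac12\right)-\mathrm{Li}_2\left(\frac{1-\alpha}{2}\right).$$
   Context: $\mathrm{Li}_2(\alpha)=\sum_{n=1}^\infty\frac{\alpha^n}{n^2}$ for $|\alpha|\le 1$ is the dilogarithm. *)

(* Defs.v *)
From Stdlib Require Import Reals.
From Coquelicot Require Import Coquelicot.
Open Scope R_scope.

(** The series converges exactly for [Rabs a <= 1]; outside that range
    [Series] returns a meaningless value. The summation index is shifted so
    that the sum starts at exponent 1. *)
Definition Li2 (a : R) : R := Series (fun n : nat => a ^ S n / INR (S n) ^ 2).

(* Main.v *)
Require Import Defs.
From Stdlib Require Import Reals Lra.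
From Coquelicot Require Import Coquelicot.
Open Scope R_scope.

(** Differentiating under the integral sign, for [-1 < alpha < 1] the integral
    has derivative
    [RInt (fun x => / ((1 + alpha * x) * (1 + x))) 0 1
     = (ln 2 - ln (1 + alpha)) / (1 - alpha)],
    which is also the derivative of [- Li2 ((1 - alpha) / 2)] because
    [u * Li2' u = - ln (1 - u)].  Both sides of the claim vanish at
    [alpha = 0] and are continuous up to [alpha = 1]. *)

(** * Power series of the logarithm and the dilogarithm *)

Lemma CV_radius_ge_1 (a : nat -> R) :
  (forall n, Rabs (a n) <= 1) -> Rbar_le 1 (CV_radius a).
Proof.
intros Ha.
apply (proj1 (CV_radius_bounded a)).
exists 1; intros n.
now rewrite pow1, Rmult_1_r.
Qed.

Lemma Rabs_Rinv_INR_le_1 (n : nat) : Rabs (/ INR (S n)) <= 1.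
Proof.
assert (H : 1 <= INR (S n)) by (rewrite S_INR; pose proof (pos_INR n); lra).
rewrite Rabs_pos_eq by (left; apply Rinv_0_lt_compat; lra).
rewrite <- Rinv_1; apply Rinv_le_contravar; lra.
Qed.

Lemma CV_radius_inv_ge_1 : Rbar_le 1 (CV_radius (fun n => / INR (S n))).
Proof. exact (CV_radius_ge_1 _ Rabs_Rinv_INR_le_1). Qed.

Lemma CV_radius_inv2_ge_1 : Rbar_le 1 (CV_radius (fun n => / INR (S n) ^ 2)).
Proof.
apply CV_radius_ge_1; intros n.
rewrite <- pow_inv, <- RPow_abs.
pose proof (Rabs_Rinv_INR_le_1 n); pose proof (Rabs_pos (/ INR (S n))).
rewrite <- (pow1 2); apply pow_incr; lra.
Qed.

Lemma Rbar_lt_Rabs_ge_1 (u : R) (r : Rbar) :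
  -1 < u < 1 -> Rbar_le 1 r -> Rbar_lt (Rabs u) r.
Proof.
intros Hu Hr.
apply Rbar_lt_le_trans with 1; [apply Rabs_def1; lra | exact Hr].
Qed.

Lemma ex_derive_continuity_pt (f : R -> R) (x : R) :
  ex_derive f x -> continuity_pt f x.
Proof.
intros H; apply continuity_pt_filterlim.
exact (ex_derive_continuous f x H).
Qed.

(** The left side plus [ln (1 - u)] vanishes at [0] and has derivative zero, since differentiating
    term by term gives the geometric series. The factor [u] avoids a division at [u = 0]. *)
Lemma PSeries_ln (u : R) :
  -1 < u < 1 -> u * PSeries (fun n => / INR (S n)) u = - ln (1 - u).
Proof.
intros Hu.
set (c := fun n : nat => / INR (S n)).
assert (Hd : forall x, -1 < x < 1 ->
  is_derive (fun x => PSeries (PS_incr_1 c) x + ln (1 - x)) x 0).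
{ intros x Hx.
  replace 0 with (/ (1 - x) + - / (1 - x)) by ring.
  apply (is_derive_plus (PSeries (PS_incr_1 c)) (fun x => ln (1 - x))).
  - replace (/ (1 - x)) with (PSeries (PS_derive (PS_incr_1 c)) x).
    { apply is_derive_PSeries; rewrite CV_radius_incr_1.
      exact (Rbar_lt_Rabs_ge_1 x _ Hx CV_radius_inv_ge_1). }
    rewrite <- Series_geom by (apply Rabs_def1; lra).
    apply Series_ext; intros n.
    unfold PS_derive, PS_incr_1, c.
    rewrite Rinv_r by (apply not_0_INR; discriminate).
    ring.
  - auto_derive; [lra | field; lra]. }
destruct (MVT_gen (fun x => PSeries (PS_incr_1 c) x + ln (1 - x)) 0 u
  (fun _ => 0)) as [d [_ H]].
- intros x Hx; apply Hd.
  unfold Rmin, Rmax in Hx; destruct (Rle_dec 0 u); lra.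
- intros x Hx.
  apply ex_derive_continuity_pt.
  exists 0; apply Hd.
  unfold Rmin, Rmax in Hx; destruct (Rle_dec 0 u); lra.
- rewrite !PSeries_incr_1, Rminus_0_r, ln_1 in H; lra.
Qed.

Lemma Li2_PSeries (u : R) :
  Li2 u = PSeries (PS_incr_1 (fun n => / INR (S n) ^ 2)) u.
Proof.
rewrite PSeries_incr_1; unfold PSeries, Li2.
rewrite <- Series_scal_l.
apply Series_ext; intros n.
unfold Rdiv; simpl; ring.
Qed.

(** Termwise differentiation cancels one factor [S n]. Keeping the derivative as a series covers
    [u = 0], which is where [(1 - a) / 2] lands at the endpoint [a = 1]. *)
Lemma is_derive_Li2_PSeries (u : R) :
  -1 < u < 1 -> is_derive Li2 u (PSeries (fun n => / INR (S n)) u).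
Proof.
intros Hu.
apply (is_derive_ext (PSeries (PS_incr_1 (fun n => / INR (S n) ^ 2)))).
{ intros t; symmetry; apply Li2_PSeries. }
replace (PSeries (fun n => / INR (S n)) u)
  with (PSeries (PS_derive (PS_incr_1 (fun n => / INR (S n) ^ 2))) u).
- apply is_derive_PSeries; rewrite CV_radius_incr_1.
  exact (Rbar_lt_Rabs_ge_1 u _ Hu CV_radius_inv2_ge_1).
- apply PSeries_ext; intros n.
  unfold PS_derive, PS_incr_1.
  field; apply not_0_INR; discriminate.
Qed.

Lemma is_derive_Li2 (u : R) :
  -1 < u < 1 -> u <> 0 -> is_derive Li2 u (- ln (1 - u) / u).
Proof.
intros Hu Hu0.
rewrite <- (PSeries_ln u Hu).
replace (u * _ / u) with (PSeries (fun n => / INR (S n)) u) by (field; lra).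
now apply is_derive_Li2_PSeries.
Qed.

(** * Differentiation under the integral sign *)

Lemma one_plus_mult_pos (a t : R) : -1 < a -> 0 <= t <= 1 -> 0 < 1 + a * t.
Proof.
intros Ha Ht.
(* For negative [a], use [1 + a * t = (1 + a) + (- a) * (1 - t)]. *)
destruct (Rle_lt_dec 0 a); [ | assert (0 <= - a * (1 - t))]; nra.
Qed.

(** The integrand with its removable singularity at [t = 0] filled in. *)
Definition kernel (a t : R) : R :=
  (if Req_EM_T t 0 then a else ln (1 + a * t) / t) / (1 + t).

Lemma is_derive_kernel (a t : R) :
  0 < 1 + a * t -> 0 < 1 + t ->
  is_derive (fun z => kernel z t) a (/ ((1 + a * t) * (1 + t))).
Proof.
intros Ha Ht; unfold kernel.
destruct (Req_EM_T t 0) as [-> | Ht0]; auto_derive; try lra.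
- field; lra.
- field; lra.
Qed.

Lemma continuous_kernel (a t : R) :
  -1 < a -> 0 <= t <= 1 -> continuous (kernel a) t.
Proof.
intros Ha Ht.
apply (continuous_mult
  (fun t => if Req_EM_T t 0 then a else ln (1 + a * t) / t)
  (fun t => / (1 + t))).
2: { apply (ex_derive_continuous (K := R_AbsRing) (V := R_NormedModule)).
  auto_derive; lra. }
destruct (Req_dec t 0) as [-> | Ht0].
(* Away from [0] the numerator of the kernel is the difference quotient of [ln (1 + a * t)] at [0],
   so continuity there is exactly this derivative. *)
- assert (Hd : is_derive (fun t => ln (1 + a * t)) 0 a).
  { auto_derive; [lra | field; lra]. }
  apply is_derive_Reals in Hd.
  apply filterlim_locally; intros eps.
  destruct (Hd eps (cond_pos eps)) as [delta Hdelta].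
  exists delta; intros y Hy.
  change (Rabs (y - 0) < delta) in Hy; rewrite Rminus_0_r in Hy.
  change (Rabs ((if Req_EM_T y 0 then a else ln (1 + a * y) / y)
    - (if Req_EM_T 0 0 then a else ln (1 + a * 0) / 0)) < eps).
  destruct (Req_EM_T 0 0) as [_ | []]; [ | reflexivity].
  destruct (Req_EM_T y 0) as [Hy0 | Hy0].
  + rewrite Rminus_diag, Rabs_R0; apply cond_pos.
  + specialize (Hdelta y Hy0 Hy).
    now rewrite Rplus_0_l, Rmult_0_r, Rplus_0_r, ln_1, Rminus_0_r in Hdelta.
- apply (continuous_ext_loc _ (fun t => ln (1 + a * t) / t)).
  + apply (filter_imp (fun y : R => 0 < y)); [ | apply open_gt; lra].
    intros y Hy; destruct (Req_EM_T y 0); [lra | reflexivity].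
  + apply (ex_derive_continuous (K := R_AbsRing) (V := R_NormedModule)).
    auto_derive.
    split; [now apply one_plus_mult_pos | lra].
Qed.

Lemma ex_RInt_kernel (a : R) : -1 < a -> ex_RInt (kernel a) 0 1.
Proof.
intros Ha; apply (ex_RInt_continuous (V := R_CompleteNormedModule)).
intros z Hz; rewrite Rmin_left, Rmax_right in Hz by lra.
now apply continuous_kernel.
Qed.

Lemma continuity_2d_pt_Derive_kernel (a t : R) :
  -1 < a -> 0 <= t <= 1 ->
  continuity_2d_pt (fun u v => Derive (fun z => kernel z v) u) a t.
Proof.
intros Ha Ht.
assert (Hat : 0 < 1 + a * t) by now apply one_plus_mult_pos.
assert (Ht1 : 0 < 1 + t) by lra.
assert (Cat : continuity_2d_pt (fun u v => 1 + u * v) a t).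
{ apply continuity_2d_pt_plus; [apply continuity_2d_pt_const | ].
  apply continuity_2d_pt_mult;
    [apply continuity_2d_pt_id1 | apply continuity_2d_pt_id2]. }
assert (Ct : continuity_2d_pt (fun u v => 1 + v) a t).
{ apply continuity_2d_pt_plus;
    [apply continuity_2d_pt_const | apply continuity_2d_pt_id2]. }
apply continuity_2d_pt_ext_loc with (fun u v => / ((1 + u * v) * (1 + v))).
(* Taking the values [1 + a * t] and [1 + t] themselves as tolerances keeps both factors positive
   nearby, so the closed form of the derivative holds there. *)
- generalize (locally_2d_and _ _ _ _
    (Cat (mkposreal _ Hat)) (Ct (mkposreal _ Ht1))).
  apply locally_2d_impl, locally_2d_forall; simpl; intros u v [Hu Hv].
  apply Rabs_def2 in Hu; apply Rabs_def2 in Hv.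
  symmetry; apply is_derive_unique, is_derive_kernel; lra.
- apply continuity_2d_pt_inv; [now apply continuity_2d_pt_mult | nra].
Qed.

Lemma is_derive_RInt_kernel (a : R) :
  -1 < a ->
  is_derive (fun a => RInt (kernel a) 0 1) a
    (RInt (fun t => / ((1 + a * t) * (1 + t))) 0 1).
Proof.
intros Ha.
rewrite (RInt_ext _ (fun t => Derive (fun z => kernel z t) a)).
- apply (is_derive_RInt_param kernel).
  + apply (filter_imp (fun y : R => -1 < y)); [ | now apply open_gt].
    intros y Hy t Ht; rewrite Rmin_left, Rmax_right in Ht by lra.
    eexists; apply is_derive_kernel; [apply one_plus_mult_pos | ]; lra.
  + intros t Ht; rewrite Rmin_left, Rmax_right in Ht by lra.
    now apply continuity_2d_pt_Derive_kernel.
  + apply (filter_imp (fun y : R => -1 < y)); [ | now apply open_gt].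
    exact ex_RInt_kernel.
- intros t Ht; rewrite Rmin_left, Rmax_right in Ht by lra.
  symmetry; apply is_derive_unique, is_derive_kernel; [apply one_plus_mult_pos | ]; lra.
Qed.

(** * Matching the two derivatives and integrating back *)

Lemma RInt_inv_mul (a : R) :
  -1 < a < 1 ->
  RInt (fun t => / ((1 + a * t) * (1 + t))) 0 1
  = (ln 2 - ln (1 + a)) / (1 - a).
Proof.
intros Ha.
(* Partial fractions: the integrand is [(/ (1 + t) - a / (1 + a * t)) / (1 - a)]. *)
pose (F := fun t => (ln (1 + t) - ln (1 + a * t)) / (1 - a)).
replace ((ln 2 - ln (1 + a)) / (1 - a)) with (minus (F 1) (F 0)).
2: { unfold F, minus, plus, opp; simpl.
  rewrite Rmult_0_r, Rmult_1_r, Rplus_0_r, ln_1.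
  replace (1 + 1) with 2 by ring; field; lra. }
apply is_RInt_unique, (is_RInt_derive (V := R_CompleteNormedModule)).
- intros t Ht; rewrite Rmin_left, Rmax_right in Ht by lra.
  pose proof (one_plus_mult_pos a t ltac:(lra) Ht).
  unfold F; auto_derive; [lra | field; lra].
- intros t Ht; rewrite Rmin_left, Rmax_right in Ht by lra.
  pose proof (one_plus_mult_pos a t ltac:(lra) Ht).
  apply (ex_derive_continuous (K := R_AbsRing) (V := R_NormedModule)).
  auto_derive; nra.
Qed.

Lemma is_derive_Li2_half_sub (a : R) :
  -1 < a < 1 ->
  is_derive (fun a => Li2 ((1 - a) / 2)) a (- ((ln 2 - ln (1 + a)) / (1 - a))).
Proof.
intros Ha.
replace (- ((ln 2 - ln (1 + a)) / (1 - a)))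
  with (scal (- / 2) (- ln (1 - (1 - a) / 2) / ((1 - a) / 2))).
- apply (is_derive_comp Li2 (fun a => (1 - a) / 2)).
  + apply is_derive_Li2; lra.
  + auto_derive; [exact I | field].
- replace (1 - (1 - a) / 2) with ((1 + a) / 2) by field.
  rewrite ln_div by lra.
  unfold scal; simpl; unfold mult; simpl; field; lra.
Qed.

(** The integral plus [Li2 ((1 - a) / 2)] is constant in [a], and at [a = 0] the kernel vanishes.
    The mean value theorem asks for the zero derivative only strictly between [0] and [a], so
    [a = 1] needs mere continuity. *)
Lemma RInt_kernel (a : R) :
  -1 < a <= 1 -> RInt (kernel a) 0 1 = Li2 (1 / 2) - Li2 ((1 - a) / 2).
Proof.
intros Ha.
destruct (MVT_gen (fun a => RInt (kernel a) 0 1 + Li2 ((1 - a) / 2)) 0 a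
  (fun _ => 0)) as [d [_ H]].
- intros x Hx.
  assert (Hx' : -1 < x < 1)
    by (unfold Rmin, Rmax in Hx; destruct (Rle_dec 0 a); lra).
  pose proof (is_derive_plus (fun a => RInt (kernel a) 0 1) _ x _ _
    (is_derive_RInt_kernel x (proj1 Hx')) (is_derive_Li2_half_sub x Hx')) as Hd.
  rewrite (RInt_inv_mul x Hx') in Hd.
  unfold plus in Hd; simpl in Hd.
  now rewrite Rplus_opp_r in Hd.
- intros x Hx.
  assert (Hx' : -1 < x <= 1)
    by (unfold Rmin, Rmax in Hx; destruct (Rle_dec 0 a); lra).
  apply ex_derive_continuity_pt.
  apply (ex_derive_plus (fun a => RInt (kernel a) 0 1)
    (fun a => Li2 ((1 - a) / 2))).
  + eexists; now apply is_derive_RInt_kernel.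
  + apply (ex_derive_comp Li2 (fun a => (1 - a) / 2)).
    * eexists; apply is_derive_Li2_PSeries; lra.
    * auto_derive; exact I.
- assert (H0 : RInt (kernel 0) 0 1 = 0).
  { rewrite (RInt_ext _ (fun _ => 0)).
    - rewrite RInt_const; unfold scal; simpl; unfold mult; simpl; ring.
    - intros t _; unfold kernel.
      change (@eq R ((if Req_EM_T t 0 then 0 else ln (1 + 0 * t) / t)
        / (1 + t)) 0).
      destruct (Req_EM_T t 0); rewrite ?Rmult_0_l, ?Rplus_0_r, ?ln_1;
        unfold Rdiv; ring. }
  rewrite H0, (Rminus_0_r 1) in H; lra.
Qed.

Theorem proposition5 (alpha : R) (halpha : -1 < alpha <= 1) :
  is_RInt (fun x : R => ln (1 + alpha * x) / (x * (1 + x))) 0 1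
    (Li2 (1 / 2) - Li2 ((1 - alpha) / 2)).
Proof.
(* Agreement is required only on the open interval, so the value of the integrand at [x = 0], a
   division by zero, does not matter. *)
apply (is_RInt_ext (kernel alpha)).
- intros x Hx; rewrite Rmin_left, Rmax_right in Hx by lra.
  unfold kernel; destruct (Req_EM_T x 0); [lra | ].
  change (@eq R (ln (1 + alpha * x) / x / (1 + x))
    (ln (1 + alpha * x) / (x * (1 + x)))).
  field; lra.
- rewrite <- (RInt_kernel alpha halpha).
  apply (RInt_correct (V := R_CompleteNormedModule)), ex_RInt_kernel; lra.
Qed.
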